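(* Let $A=[a_{i,j}]\in\mathbb{C}^{m\times m}$. If $$m\,\mathrm{Trace}(A^2)\neq(\mathrm{Trace}(A))^2,$$ then the unique closest generalized Hermitian matrix $\widehat{A}=[\widehat{a}_{i,j}]\in\mathbb{C}^{m\times m}$ to $A$ in the Frobenius norm is given by $$\widehat{a}_{i,j}=\begin{cases}\frac{1}{2}\left(a_{i,j}+\overline{a}_{j,i}\,\mathrm{e}^{\mathrm{i}\widehat{\theta}}\right), & \text{if } i\neq j,\\[2pt] \frac{1}{2}\left(a_{i,i}+\overline{a}_{i,i}\,\mathrm{e}^{\mathrm{i}\widehat{\theta}}+\widehat{\gamma}\,\mathrm{e}^{\mathrm{i}\frac{\widehat{\theta}+\pi}{2}}\right), & \text{if } i=j,\end{cases}$$ where $$\widehat{\theta}=\arg\left(\mathrm{Trace}(A^2)-\frac{1}{m}(\mathrm{Trace}(A))^2\right),\qquad \widehat{\gamma}=\frac{2}{m}\,\mathrm{Im}\left(\mathrm{e}^{-\mathrm{i}\frac{\widehat{\theta}}{2}}\mathrm{Trace}(A)\right).$$ Moreover, the distance of $A$ to the set $\mathbb{G}$ of generalized Hermitian matrices is given by $$\mathrm{dist}_F(A,\mathbb{G})=\sqrt{\frac{\|A\|_F^2}{2}-\frac{1}{2}\mathrm{Re}\left(\mathrm{e}^{-\mathrm{i}\widehat{\theta}}\sum_{i,j=1}^m a_{i,j}a_{j,i}\right)-\frac{1}{m}\left(\mathrm{Im}\left(\mathrm{e}^{-\mathrm{i}\frac{\widehat{\theta}}{2}}\sum_{i=1}^m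 a_{i,i}\right)\right)^2}.$$ If instead $m\,\mathrm{Trace}(A^2)=(\mathrm{Trace}(A))^2$, then there are infinitely many generalized Hermitian matrices $\widehat{A}(\theta)=[\widehat{a}_{i,j}(\theta)]\in\mathbb{C}^{m\times m}$, depending on an arbitrary angle $\theta$, at the same minimal distance from $A$, whose entries are given by $$\widehat{a}_{i,j}(\theta)=\begin{cases}\frac{1}{2}\left(a_{i,j}+\overline{a}_{j,i}\,\mathrm{e}^{\mathrm{i}\theta}\right), & \text{if } i\neq j,\\[2pt] \frac{1}{2}\left(a_{i,i}+\overline{a}_{i,i}\,\mathrm{e}^{\mathrm{i}\theta}+\widehat{\gamma}(\theta)\,\mathrm{e}^{\mathrm{i}\frac{\theta+\pi}{2}}\right), & \text{if } i=j,\end{cases}$$ where $\widehat{\gamma}(\theta)=\frac{2}{m}\,\mathrm{Im}\left(\mathrm{e}^{-\mathrm{i}\frac{\theta}{2}}\mathrm{Trace}(A)\right)$.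
   Context: A matrix $Z\in\mathbb{C}^{m\times m}$ is called generalized Hermitian if it is normal (unitarily diagonalizable) and its eigenvalues are collinear, i.e., lie on a common straight line in the complex plane; equivalently, $Z=\mathrm{e}^{\mathrm{i}\varphi}B+\alpha I$ for some $\varphi\in(-\pi,\pi]$, $\alpha\in\mathbb{C}$ and Hermitian $B$. The set of all such $m\times m$ matrices is denoted $\mathbb{G}$. The Frobenius norm is $\|M\|_F=(\mathrm{trace}(M^*M))^{1/2}$, and $\mathrm{dist}_F(A,\mathbb{G})=\inf_{Z\in\mathbb{G}}\|A-Z\|_F$. The bar denotes complex conjugation, $\arg$ is the argument of a nonzero complex number (taken in $(-\pi,\pi]$), $\mathrm{i}=\sqrt{-1}$ in exponents (roman), and italic $i,j$ are indices.
   Formalization: In the case m Trace(A²) = (Trace A)², ''infinitely many'' is asserted only when A is not a scalar matrix cI; for A = cI (always so if m = 1) every Â(θ) equals A, which is then the unique closest matrix. *)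

(* Defs.v *)
From HB Require Import structures.
From mathcomp Require Import all_boot all_order all_algebra.
From mathcomp Require Import spectral.
From mathcomp Require Import all_classical all_reals all_analysis.
From mathcomp Require Import complex.

Set Implicit Arguments.
Unset Strict Implicit.
Unset Printing Implicit Defensive.

Import Order.TTheory GRing.Theory Num.Theory.
Local Open Scope classical_set_scope.
Local Open Scope ring_scope.
Local Open Scope sesquilinear_scope.

Section Complex.
Variable R : realType.
Implicit Types (t : R) (z : R[i]).

Definition expi t : R[i] := (cos t +i* sin t)%C.

(* argc 0 = pi / 2 is a junk value. *)
Definition argc z : R :=
  let: (x +i* y)%C := z in
  let a := acos (x / Num.sqrt (x ^+ 2 + y ^+ 2)) in
  if 0 <= y then a else - a.

Lemma argcP z : z != 0 ->
  [/\ - pi < argc z, argc z <= pi & z = `|z| * expi (argc z)].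
Proof.
case: z => x y nz.
have r0 : 0 < x ^+ 2 + y ^+ 2.
  rewrite lt_def addr_ge0 ?sqr_ge0// andbT.
  apply: contra_neq nz => /eqP; rewrite paddr_eq0 ?sqr_ge0//.
  by rewrite !sqrf_eq0 => /andP[/eqP-> /eqP->].
rewrite normc_def /expi /argc /=; set r := Num.sqrt _.
have rgt0 : 0 < r by rewrite sqrtr_gt0.
have rE : r ^+ 2 = x ^+ 2 + y ^+ 2 by rewrite sqr_sqrtr// ltW.
have sq1 : (x / r) ^+ 2 + (y / r) ^+ 2 = 1.
  by rewrite !expr_div_n -mulrDl -rE divff// sqrf_eq0 gt_eqF.
have x1 : -1 <= x / r <= 1.
  rewrite -ler_norml -(@ler_pXn2r _ 2%N) ?nnegrE// expr1n real_normK ?num_real//.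
  by rewrite -sq1 lerDl sqr_ge0.
have ca : cos (acos (x / r)) = x / r by rewrite acosK// in_itv.
have sa : sin (acos (x / r)) = `|y| / r.
  rewrite sin_acos//; have -> : 1 - (x / r) ^+ 2 = (y / r) ^+ 2.
    by rewrite -sq1 addrAC subrr add0r.
  by rewrite sqrtr_sqr normrM normfV (gtr0_norm rgt0).
have rr (u : R) : r * (u / r) = u by rewrite mulrCA divff ?mulr1// gt_eqF.
have [y0|y0] := leP 0 y; split.
- by rewrite (lt_le_trans _ (acos_ge0 x1))// oppr_lt0 pi_gt0.
- exact: acos_lepi.
- rewrite ca sa ger0_norm//; apply/eqP; rewrite eq_complex /=.
  by rewrite !mul0r subr0 addr0 !rr !eqxx.
- rewrite ltrN2 acos_ltpi//; case/andP: x1 => x1 ->; rewrite andbT.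
  rewrite lt_neqAle x1 andbT eq_sym; apply/eqP => xm1.
  move: sq1; rewrite xm1 sqrrN expr1n -[RHS]addr0 => /addrI/eqP.
  by rewrite sqrf_eq0 mulf_eq0 invr_eq0 (lt_eqF y0) (gt_eqF rgt0).
- by rewrite (le_trans _ (pi_ge0 R))// oppr_le0 acos_ge0.
- rewrite cosN sinN ca sa ltr0_norm// mulNr opprK.
  apply/eqP; rewrite eq_complex /=.
  by rewrite !mul0r subr0 addr0 !rr !eqxx.
Qed.

End Complex.

Section GeneralizedHermitian.
Variables (R : realType) (m : nat).
Implicit Types (A Z : 'M[R[i]]_m) (G : set 'M[R[i]]_m).

(* The trace is real and nonnegative, so taking its real part loses nothing. *)
Definition normF A : R := Num.sqrt (complex.Re (\tr (A^t* *m A))).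

Definition distF A G : R := inf [set normF (A - Z) | Z in G].

Definition collinear (S : set R[i]) : Prop :=
  exists p d : R[i], d != 0 /\
    forall a, S a -> exists t : R, a = p + (t%:C)%C * d.

Definition gen_hermitian : set 'M[R[i]]_m :=
  [set Z | Z \is normalmx /\ collinear [set a | eigenvalue Z a]].

Definition closest G A Z : Prop :=
  G Z /\ forall W, G W -> normF (A - Z) <= normF (A - W).

Definition gamma_hat A (theta : R) : R :=
  2 / m%:R * complex.Im (expi (- (theta / 2)) * \tr A).

Definition A_hat A (theta : R) : 'M[R[i]]_m :=
  \matrix_(i, j)
    if i != j then
      2^-1 * (A i j + (A j i)^* * expi theta)
    else
      2^-1 * (A i i + (A i i)^* * expi theta
              + (gamma_hat A theta)%:C%C * expi ((theta + pi) / 2)).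

Definition theta_hat A : R :=
  argc (\tr (A *m A) - m%:R^-1 * (\tr A) ^+ 2).

End GeneralizedHermitian.

(* Main.v *)
Require Import Defs.
From mathcomp Require Import all_boot all_order all_algebra.
From mathcomp Require Import all_classical all_reals all_analysis.
From mathcomp Require Import complex spectral ring.

(** A matrix is generalized Hermitian iff its traceless part Z satisfies
    Z = u Z' for some unit u, where Z' is the conjugate transpose.  Write
    A = (tr A / m) I + A0 with A0 traceless and fix u.  The map X |-> u X' is an
    isometric involution for the real inner product Re (tr (X' Y)), so the
    nearest matrix of this kind is obtained by keeping the scalar part and
    replacing A0 with (A0 + u A0') / 2.  The squared error is
    (|A0|^2 - Re (conj u * c)) / 2 with c = tr (A0^2) = tr (A^2) - (tr A)^2 / m;
    it is minimal exactly when conj u * c = |c|, which determines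
    u = exp (i arg c) if c <> 0 and does not constrain u if c = 0. *)

Set Implicit Arguments.
Unset Strict Implicit.
Unset Printing Implicit Defensive.

Import Order.TTheory GRing.Theory Num.Theory.
Local Open Scope classical_set_scope.
Local Open Scope ring_scope.

(** * Adjoints and the squared Frobenius norm *)

Section AdjointMatrix.
Variable C : numClosedFieldType.
Local Open Scope sesquilinear_scope.

Lemma adjmxD m n (A B : 'M[C]_(m, n)) : (A + B)^t* = A^t* + B^t*.
Proof. by rewrite linearD map_mxD. Qed.

Lemma adjmxB m n (A B : 'M[C]_(m, n)) : (A - B)^t* = A^t* - B^t*.
Proof. by rewrite linearB map_mxB. Qed.

Lemma adjmxZ m n a (A : 'M[C]_(m, n)) : (a *: A)^t* = a^* *: A^t*.
Proof. by rewrite linearZ map_mxZ. Qed.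

Lemma adjmxM m n p (A : 'M[C]_(m, n)) (B : 'M[C]_(n, p)) :
  (A *m B)^t* = B^t* *m A^t*.
Proof. by rewrite trmx_mul map_mxM. Qed.

Lemma adjmx_scalar n a : (a%:M : 'M[C]_n)^t* = (a^*)%:M.
Proof. by rewrite tr_scalar_mx map_scalar_mx. Qed.

Lemma mxtrace_adj n (A : 'M[C]_n) : \tr (A^t* ) = (\tr A)^*.
Proof. by rewrite trace_map_mx mxtrace_tr. Qed.

(** Kept squared and valued in [C], so that norm computations are trace identities; [normF_le] and
    [normF_sqr] carry the results back to [normF]. *)
Definition sqnormF m n (A : 'M[C]_(m, n)) : C := \tr (A^t* *m A).

Lemma sqnormFE m n (A : 'M[C]_(m, n)) :
  sqnormF A = \sum_j \sum_i `|A i j| ^+ 2.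
Proof.
apply: eq_bigr => j _; rewrite mxE; apply: eq_bigr => i _.
by rewrite !mxE normCKC.
Qed.

Lemma sqnormF_ge0 m n (A : 'M[C]_(m, n)) : 0 <= sqnormF A.
Proof. by rewrite sqnormFE !sumr_ge0// => j _; rewrite sumr_ge0. Qed.

Lemma sqnormF_eq0 m n (A : 'M[C]_(m, n)) : (sqnormF A == 0) = (A == 0).
Proof.
apply/eqP/eqP => [|->]; last by rewrite /sqnormF mulmx0 mxtrace0.
rewrite sqnormFE => /psumr_eq0P h; apply/matrixP => i j; rewrite mxE.
have /psumr_eq0P-/(_ (fun _ _ => exprn_ge0 _ (normr_ge0 _)) i isT)/eqP :=
  h (fun _ _ => sumr_ge0 _ (fun _ _ => exprn_ge0 _ (normr_ge0 _))) j isT.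
by rewrite sqrf_eq0 normr_eq0 => /eqP.
Qed.

(** * Traceless parts and orthogonal splitting of the error *)

Definition traceless m (A : 'M[C]_m) : 'M[C]_m := A - (\tr A / m%:R)%:M.

(* The orthogonal projection of [A] onto the fixed points of
   [X |-> u X^*], when [u] is a unit. *)
Definition rot_herm m (u : C) (A : 'M[C]_m) : 'M[C]_m :=
  2^-1 *: (A + u *: A^t* ).

Lemma mxtrace_traceless m (A : 'M[C]_m) : (0 < m)%N -> \tr (traceless A) = 0.
Proof.
move=> m0; rewrite raddfB /= mxtrace_scalar -[X in _ - X]mulr_natr.
rewrite divfK ?subrr//.
by rewrite pnatr_eq0 -lt0n.
Qed.

Lemma tracelessK m (A : 'M[C]_m) : A = (\tr A / m%:R)%:M + traceless A.
Proof. by rewrite addrC subrK. Qed.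

Lemma traceless_scalar m a : (0 < m)%N -> traceless (a%:M : 'M[C]_m) = 0.
Proof.
move=> m0; rewrite /traceless mxtrace_scalar -[X in X / _]mulr_natr.
rewrite mulfK ?subrr//.
by rewrite pnatr_eq0 -lt0n.
Qed.

Lemma tracelessD m (A B : 'M[C]_m) :
  traceless (A + B) = traceless A + traceless B.
Proof.
rewrite /traceless raddfD /= mulrDl raddfD /=.
by rewrite opprD addrACA.
Qed.

Lemma tracelessZ m a (A : 'M[C]_m) : traceless (a *: A) = a *: traceless A.
Proof.
by rewrite /traceless mxtraceZ -mulrA scalerBr scale_scalar_mx.
Qed.

Lemma traceless_adj m (A : 'M[C]_m) : traceless (A^t* ) = (traceless A)^t*.
Proof.
by rewrite /traceless mxtrace_adj adjmxB adjmx_scalar fmorph_div /= rmorph_nat.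
Qed.

Lemma traceless_id m (A : 'M[C]_m) : \tr A = 0 -> traceless A = A.
Proof. by rewrite /traceless => ->; rewrite mul0r raddf0 subr0. Qed.

(** Pythagoras: scalar matrices are orthogonal to traceless ones, the cross terms being multiples of
    the trace of [A] or its conjugate. *)
Lemma sqnormF_scalarD m a (A : 'M[C]_m) : \tr A = 0 ->
  sqnormF (a%:M + A) = m%:R * `|a| ^+ 2 + sqnormF A.
Proof.
move=> trA; rewrite /sqnormF adjmxD adjmx_scalar mulmxDl !mulmxDr !raddfD /=.
rewrite mul_scalar_mx mxtraceZ mxtrace_scalar mul_scalar_mx mxtraceZ.
rewrite mul_mx_scalar mxtraceZ mxtrace_adj trA rmorph0 !mulr0 addr0 add0r.
by rewrite -mulr_natl normCKC; ring.
Qed.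

(* [E] is skew and [F] is symmetric for the antilinear isometry
   [X |-> u X^*], so they are orthogonal for the real inner product. *)
Lemma sqnormF_orthoD m u (E F : 'M[C]_m) : u * u^* = 1 ->
  u *: E^t* = - E -> u *: F^t* = F ->
  sqnormF (E + F) = sqnormF E + sqnormF F.
Proof.
move=> u1 hE hF.
have uu : u^* * u = 1 by rewrite mulrC.
have {}hE : E^t* = - u^* *: E.
  by rewrite scaleNr -scalerN -hE scalerA uu scale1r.
have {}hF : F^t* = u^* *: F by rewrite -{2}hF scalerA uu scale1r.
rewrite /sqnormF adjmxD mulmxDl !mulmxDr !raddfD /= hE hF.
rewrite -!scalemxAl !mxtraceZ (mxtrace_mulC F E); ring.
Qed.

(** The residual is half of [A - u *: A^t*]. On expanding, both square terms equal [sqnormF A] and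
    the two cross terms are conjugate to each other, whence the real part. *)
Lemma sqnormF_sub_rot_herm m u (A : 'M[C]_m) : u * u^* = 1 ->
  sqnormF (A - rot_herm u A) = 2^-1 * (sqnormF A - 'Re (u^* * \tr (A *m A))).
Proof.
move=> u1.
have -> : A - rot_herm u A = 2^-1 *: (A - u *: A^t* ).
  apply/matrixP => i j; by rewrite !mxE; field.
rewrite /sqnormF adjmxZ adjmxB adjmxZ trmxCK -scalemxAl -scalemxAr !mxtraceZ.
rewrite mulmxBl !mulmxBr -!scalemxAl -!scalemxAr !raddfB /= !mxtraceZ.
rewrite (mxtrace_mulC A (A^t* )) -adjmxM mxtrace_adj ReE.
rewrite [(u^* * _)^*]rmorphM /= conjCK fmorphV rmorph_nat.
by rewrite [u^* * (u * _)]mulrA [u^* * u]mulrC u1; field.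
Qed.

Lemma rot_herm_fix m u (A : 'M[C]_m) : u * u^* = 1 ->
  u *: (rot_herm u A)^t* = rot_herm u A.
Proof.
move=> u1; rewrite adjmxZ adjmxD adjmxZ trmxCK fmorphV rmorph_nat.
by rewrite scalerA mulrC -scalerA scalerDr scalerA u1 scale1r addrC.
Qed.

Lemma mxtrace_rot_herm m u (A : 'M[C]_m) : \tr A = 0 -> \tr (rot_herm u A) = 0.
Proof.
move=> h; rewrite mxtraceZ mxtraceD mxtraceZ mxtrace_adj h.
by rewrite rmorph0 !(mulr0, addr0).
Qed.

(** Three orthogonal pieces: the scalar part, the gap inside the fixed space of [u], and the
    distance from [A] to that space, which does not depend on [Z]. *)
Lemma sqnormF_sub_genherm m u a (A Z : 'M[C]_m) : u * u^* = 1 ->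
  \tr A = 0 -> \tr Z = 0 -> u *: Z^t* = Z ->
  sqnormF (a%:M + (A - Z)) = m%:R * `|a| ^+ 2 + sqnormF (rot_herm u A - Z)
    + 2^-1 * (sqnormF A - 'Re (u^* * \tr (A *m A))).
Proof.
move=> u1 trA trZ hZ; rewrite sqnormF_scalarD; last first.
  by rewrite raddfB /= trA trZ subr0.
have -> : A - Z = (A - rot_herm u A) + (rot_herm u A - Z).
  by rewrite addrA subrK.
rewrite (sqnormF_orthoD u1).
- by rewrite sqnormF_sub_rot_herm// -!addrA [X in _ + X]addrC.
- rewrite adjmxB scalerBr rot_herm_fix// opprB; apply/matrixP => i j.
  by rewrite !mxE; field.
- by rewrite adjmxB scalerBr rot_herm_fix// hZ.
Qed.

Lemma mxtrace_traceless_sqr m (A : 'M[C]_m) : (0 < m)%N ->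
  \tr (traceless A *m traceless A) = \tr (A *m A) - m%:R^-1 * \tr A ^+ 2.
Proof.
move=> m0.
rewrite {1}/traceless mulmxBl mul_scalar_mx raddfB /= mxtraceZ.
rewrite mxtrace_traceless// mulr0 subr0 /traceless mulmxBr mul_mx_scalar.
by rewrite raddfB /= mxtraceZ [X in _ - X = _]mulrAC -expr2 [_ ^+ 2 * _]mulrC.
Qed.

Lemma traceless_rot_herm m a u (A : 'M[C]_m) : (0 < m)%N ->
  traceless (a%:M + rot_herm u (traceless A)) = rot_herm u (traceless A).
Proof.
move=> m0; rewrite tracelessD traceless_scalar// add0r traceless_id//.
by rewrite mxtrace_rot_herm// mxtrace_traceless.
Qed.

Lemma sqnormF_sub_genherm_traceless m u (A Z : 'M[C]_m) : (0 < m)%N ->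
  u * u^* = 1 -> u *: (traceless Z)^t* = traceless Z ->
  sqnormF (A - Z) = m%:R * `|(\tr A - \tr Z) / m%:R| ^+ 2
    + sqnormF (rot_herm u (traceless A) - traceless Z)
    + 2^-1 * (sqnormF (traceless A)
              - 'Re (u^* * \tr (traceless A *m traceless A))).
Proof.
move=> m0 u1 hZ; rewrite -sqnormF_sub_genherm ?mxtrace_traceless//.
rewrite [in LHS](tracelessK A) [in LHS](tracelessK Z) opprD addrACA mulrBl.
by rewrite [in RHS]raddfB.
Qed.

Lemma sqnormF_sub_rot_herm_traceless m u (A : 'M[C]_m) : (0 < m)%N ->
  u * u^* = 1 ->
  sqnormF (A - ((\tr A / m%:R)%:M + rot_herm u (traceless A))) =
    2^-1 * (sqnormF (traceless A)
            - 'Re (u^* * \tr (traceless A *m traceless A))).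
Proof.
move=> m0 u1; rewrite {1}(tracelessK A) opprD addrACA subrr add0r.
exact: sqnormF_sub_rot_herm.
Qed.

Lemma rot_herm_inj m u v (A : 'M[C]_m) : A != 0 ->
  rot_herm u A = rot_herm v A -> u = v.
Proof.
move=> A0 /scalerI; rewrite invr_eq0 pnatr_eq0 => /(_ isT)/addrI/eqP.
rewrite -subr_eq0 -scalerBl scaler_eq0 subr_eq0 => /orP[/eqP//|/eqP h].
by move: A0; rewrite -[A]trmxCK h trmx0 map_mx0 eqxx.
Qed.

Lemma norm_unit (u : C) : u * u^* = 1 -> `|u| = 1.
Proof. by move=> u1; apply/eqP; rewrite -(@pexpr_eq1 _ _ 2)// normCK u1. Qed.

Lemma Re_unit_le (u c : C) : u * u^* = 1 -> 'Re (u^* * c) <= `|c|.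
Proof.
move=> u1; rewrite (le_trans (leif_Re_Creal _))//.
by rewrite normrM norm_conjC norm_unit// mul1r.
Qed.

(** The equality case: the bound is the least error over all units, and the excess over it is a sum
    of three nonnegative terms, so each one vanishes. *)
Lemma sqnormF_sub_genherm_rigid m u (A Z : 'M[C]_m) : (0 < m)%N ->
  u * u^* = 1 -> u *: (traceless Z)^t* = traceless Z ->
  sqnormF (A - Z) <= 2^-1 * (sqnormF (traceless A)
                             - `|\tr (traceless A *m traceless A)|) ->
  Z = (\tr A / m%:R)%:M + rot_herm u (traceless A) /\
  u^* * \tr (traceless A *m traceless A)
    = `|\tr (traceless A *m traceless A)|.
Proof.
move=> m0 u1 hZ; rewrite (sqnormF_sub_genherm_traceless A m0 u1 hZ).
set c := \tr (_ *m _); set s := sqnormF (traceless A).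
set x := m%:R * _; set y := sqnormF (rot_herm _ _ - _).
have x0 : 0 <= x by rewrite mulr_ge0// exprn_ge0.
have y0 : 0 <= y by exact: sqnormF_ge0.
have z0 : 0 <= 2^-1 * (`|c| - 'Re (u^* * c)).
  by rewrite mulr_ge0 ?invr_ge0// subr_ge0 Re_unit_le.
rewrite -subr_le0.
have -> : x + y + 2^-1 * (s - 'Re (u^* * c)) - 2^-1 * (s - `|c|)
    = x + y + 2^-1 * (`|c| - 'Re (u^* * c)) by ring.
move=> le0.
have : x + y + 2^-1 * (`|c| - 'Re (u^* * c)) == 0.
  by rewrite eq_le le0 !addr_ge0.
rewrite !paddr_eq0 ?addr_ge0// => /andP[/andP[]].
rewrite mulf_eq0 pnatr_eq0 eqn0Ngt m0 /= sqrf_eq0 normr_eq0.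
rewrite mulf_eq0 invr_eq0 pnatr_eq0 (eqn0Ngt m) m0 orbF subr_eq0 => /eqP trE.
rewrite sqnormF_eq0 subr_eq0 => /eqP rE.
rewrite mulf_eq0 invr_eq0 pnatr_eq0 /= subr_eq0 => /eqP cR.
split; first by rewrite rE trE -tracelessK.
have cu : `|u^* * c| = `|c| by rewrite normrM norm_conjC (norm_unit u1) mul1r.
(* A number whose real part equals its modulus is nonnegative. *)
have : 0 <= u^* * c by rewrite -(leif_Re_Creal (u^* * c)) cu -cR.
by move=> /ger0_norm <-.
Qed.

End AdjointMatrix.

(** * Generalized Hermitian matrices over the complex numbers *)

Section GenHermitian.
Variable R : realType.
Local Open Scope sesquilinear_scope.

(** Turns the spectral definition into an equation linear over the reals. Forwards, diagonalization
    gives [Z = p%:M + d *: B] with [B] Hermitian. Backwards, the adjoint of the traceless part is a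
    multiple of that part, hence commutes with it, and the eigenvalues lie on a line directed by a
    square root of [u]. *)
Lemma gen_hermitianP m (Z : 'M[R[i]]_m) : (0 < m)%N ->
  gen_hermitian Z <->
  exists u, u * u^* = 1 /\ u *: (traceless Z)^t* = traceless Z.
Proof.
move=> m0; split.
  case=> /orthomx_spectralP /=; set P := spectralmx Z; set D := spectral_diag Z.
  move=> ZE [p [d [d0 col]]].
  have Pu : P \is unitarymx := spectral_unitarymx Z.
  have Punit : P \in unitmx by exact: unitarymx_unit.
  (* [eigenvalue] is about row vectors, and the rows of [P] are such eigenvectors. *)
  have eig i : exists t : R, D 0 i = p + t%:C%C * d.
    apply: col => /=; apply/eigenvalueP; exists (row i P).
      rewrite ZE rowE !mulmxA -(mulmxA _ P) mulmxV// mulmx1.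
      by rewrite -[_ *m diag_mx D]rowE row_diag_mx -scalemxAl.
    apply/eqP => /(congr1 (fun v => v *m invmx P)).
    rewrite mul0mx rowE -mulmxA mulmxV// mulmx1 => /matrixP/(_ 0 i)/eqP.
    by rewrite !mxE !eqxx oner_eq0.
  have [t tE] := fin_all_exists eig.
  pose B := P^t* *m diag_mx (\row_i (t i)%:C%C) *m P.
  have BH : B^t* = B.
    rewrite /B !adjmxM trmxCK mulmxA; congr (_ *m _ *m _).
    rewrite tr_diag_mx map_diag_mx; congr diag_mx.
    by apply/rowP => i; rewrite !mxE; apply/CrealP/complex_realP; exists (t i).
  have ZB : Z = p%:M + d *: B.
    rewrite ZE invmx_unitary// /B.
    have -> : diag_mx D = p%:M + d *: diag_mx (\row_i (t i)%:C%C).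
      apply/matrixP => i j; rewrite !mxE tE.
      by case: eqP => _; rewrite ?mulr1n ?mulr0n ?mulr0 ?addr0// mulrC.
    rewrite mulmxDr mulmxDl -scalemxAr -scalemxAl mul_mx_scalar -scalemxAl.
    by rewrite -invmx_unitary// mulVmx// scalemx1.
  (* The adjoint turns the factor [d] of [B] into its conjugate; this quotient turns it back. *)
  exists (d / d^*); rewrite fmorph_div /= conjCK; split.
    by field; rewrite d0 conjC_eq0 d0.
  rewrite ZB tracelessD traceless_scalar// add0r tracelessZ adjmxZ.
  by rewrite -traceless_adj BH scalerA divfK// conjC_eq0.
case=> u [u1 Zu].
have [a [Z0 [ZE {}Zu]]] : exists (a : R[i]) (Z0 : 'M[R[i]]_m),
    Z = a%:M + Z0 /\ u *: Z0^t* = Z0.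
  by exists (\tr Z / m%:R), (traceless Z); rewrite -tracelessK.
have Z0E : Z0^t* = u^* *: Z0.
  by rewrite -{2}Zu scalerA [u^* * u]mulrC u1 scale1r.
split.
  apply/normalmxP; rewrite ZE adjmxD adjmx_scalar Z0E.
  rewrite !mulmxDl !mulmxDr !mul_scalar_mx !mul_mx_scalar.
  rewrite -!scalemxAl -!scalemxAr scale_scalar_mx [a * _]mulrC.
  by rewrite -scale_scalar_mx -!addrA; congr (_ + _); rewrite addrCA.
pose d := sqrtC u.
have d1 : d * d^* = 1 by rewrite -normCK -normrX sqrtCK norm_unit.
exists a, d; split.
  by apply: contra_eq_neq d1 => ->; rewrite mul0r eq_sym oner_eq0.
move=> l /= /eigenvalueP[v vZ v0].
pose b := l - a.
have vZ0 : v *m Z0 = b *: v.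
  by rewrite /b scalerBl -vZ ZE mulmxDr mul_mx_scalar addrAC subrr add0r.
(* Compare the number [v *m Z0 *m v^t*] with its conjugate. *)
have bE : b = u * b^*.
  pose s := sqnormF (v^t* ).
  have sr : s^* = s by apply: CrealP; apply: ger0_real; exact: sqnormF_ge0.
  have s0 : s != 0.
    rewrite sqnormF_eq0; apply: contra_neq v0 => h.
    by rewrite -[v]trmxCK h raddf0 map_mx0.
  have h : \tr (v *m Z0 *m v^t* ) = b * s.
    by rewrite vZ0 -scalemxAl mxtraceZ /s /sqnormF trmxCK.
  have : b * s = u * (b * s)^*.
    rewrite -h -mxtrace_adj !adjmxM trmxCK mulmxA -mxtraceZ scalemxAl.
    by rewrite scalemxAr Zu.
  by rewrite rmorphM /= sr mulrA => /(mulIf s0).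
(* With [u = d ^+ 2], the relation [bE] says that [b] is a real multiple of [d]. *)
have bd : b * d^* \is Num.real.
  apply/CrealP; rewrite rmorphM /= conjCK [in RHS]bE -(sqrtCK u) -/d expr2.
  by rewrite -[LHS]mulr1 -d1; ring.
exists (complex.Re (b * d^*)); rewrite RRe_real//.
by rewrite -mulrA [d^* * d]mulrC d1 mulr1 addrC subrK.
Qed.

(** * Passage to [normF], and exponentials of angles *)

Lemma normF_le m (A B : 'M[R[i]]_m) :
  (normF A <= normF B) = (sqnormF A <= sqnormF B).
Proof.
rewrite ler_sqrt; last by have := sqnormF_ge0 B; rewrite lecE => /andP[].
rewrite lecE -![\tr _]/(sqnormF _).
by rewrite !ger0_Im ?sqnormF_ge0// eqxx.
Qed.

Lemma normF_sqr m (A : 'M[R[i]]_m) : normF A ^+ 2 = complex.Re (sqnormF A).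
Proof.
by rewrite sqr_sqrtr//; have := sqnormF_ge0 A; rewrite lecE => /andP[].
Qed.

Lemma expiD s t : expi (s + t) = expi s * expi t :> R[i].
Proof.
rewrite /expi cosD sinD; apply/eqP; rewrite eq_complex /= eqxx.
by rewrite addrC [X in _ + X]mulrC eqxx.
Qed.

Lemma expi0 : expi 0 = 1 :> R[i].
Proof. by rewrite /expi cos0 sin0. Qed.

Lemma expiN t : expi (- t) = (expi t)^* :> R[i].
Proof. by rewrite /expi cosN sinN. Qed.

Lemma expi_unit t : expi t * (expi t)^* = 1 :> R[i].
Proof. by rewrite -expiN -expiD subrr expi0. Qed.

Lemma expi_pihalf : expi (pi / 2) = 'i%C :> R[i].
Proof. by rewrite /expi cos_pihalf sin_pihalf. Qed.

Lemma expi_half t : expi t = expi (t / 2) ^+ 2 :> R[i].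
Proof. by rewrite expr2 -expiD -splitr. Qed.

(** With [h = expi (theta / 2)] and [w = h^* * tau], multiplying [w - w^* = 2 i Im w] by [h] shows
    that the [gamma_hat] term is [tau - expi theta * tau^*]: it restores the mean [tau] on the
    diagonal. *)
Lemma A_hatE m (A : 'M[R[i]]_m) theta : (0 < m)%N ->
  A_hat A theta = (\tr A / m%:R)%:M + rot_herm (expi theta) (traceless A).
Proof.
move=> m0.
have mr : m%:R != 0 :> R[i] by rewrite pnatr_eq0 -lt0n.
have mR : m%:R != 0 :> R by rewrite pnatr_eq0 -lt0n.
set tau := \tr A / m%:R.
have gammaE : (gamma_hat A theta)%:C%C * expi ((theta + pi) / 2)
    = tau - expi theta * tau^*.
  rewrite mulrDl expiD expi_pihalf (expi_half theta); set h := expi (theta / 2).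
  have hh : h * h^* = 1 := expi_unit _.
  set w := h^* * tau.
  have gE : gamma_hat A theta = 2 * complex.Im w.
    rewrite /gamma_hat expiN -/h.
    have -> : h^* * \tr A = (m%:R)%:C%C * w.
      by rewrite rmorph_nat /w mulrCA /tau [m%:R * _]mulrC divfK.
    by case: w => x y /=; rewrite mul0r addr0; field.
  have e : w - w^* = 2 * (complex.Im w)%:C%C * 'i%C := subcJ w.
  rewrite gE rmorphM /= rmorph_nat mulrCA -e mulrBr /w rmorphM /= conjCK.
  by rewrite !mulrA hh mul1r expr2.
apply/matrixP => i j; rewrite !mxE -/tau; case: (eqVneq i j) => [<-|ij] /=.
  by rewrite gammaE mulr1n rmorphB /=; field.
by rewrite !mulr0n !subr0 add0r [_^* * _]mulrC.
Qed.

(** * Optimality and uniqueness *)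

Lemma gen_hermitian_A_hat m (A : 'M[R[i]]_m) theta : (0 < m)%N ->
  gen_hermitian (A_hat A theta).
Proof.
move=> m0; apply/gen_hermitianP => //; exists (expi theta).
by rewrite A_hatE// traceless_rot_herm// rot_herm_fix expi_unit.
Qed.

Lemma sqnormF_sub_A_hat m (A : 'M[R[i]]_m) theta : (0 < m)%N ->
  sqnormF (A - A_hat A theta) = 2^-1 * (sqnormF (traceless A)
    - 'Re ((expi theta)^* * \tr (traceless A *m traceless A))).
Proof.
by move=> m0; rewrite A_hatE// sqnormF_sub_rot_herm_traceless// expi_unit.
Qed.

Lemma Re_conj_expi (c : R[i]) theta : c = `|c| * expi theta ->
  'Re ((expi theta)^* * c) = `|c|.
Proof.
move=> cE; rewrite {1}cE mulrCA [_^* * _]mulrC expi_unit mulr1.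
by apply/Creal_ReP; exact: normr_real.
Qed.

(** The polar hypothesis serves both cases of the theorem: it fixes [theta] modulo a full turn when
    the trace is nonzero, and holds for every [theta] when it is zero. *)
Lemma closest_A_hat m (A : 'M[R[i]]_m) theta : (0 < m)%N ->
  \tr (traceless A *m traceless A)
    = `|\tr (traceless A *m traceless A)| * expi theta ->
  closest (@gen_hermitian R m) A (A_hat A theta).
Proof.
move=> m0 /Re_conj_expi hc; split; first exact: gen_hermitian_A_hat.
move=> W /gen_hermitianP -/(_ m0)[u [u1 hW]].
rewrite normF_le sqnormF_sub_A_hat// hc.
rewrite (sqnormF_sub_genherm_traceless A m0 u1 hW).
rewrite -[leLHS]add0r lerD//.
  by rewrite addr_ge0 ?sqnormF_ge0// mulr_ge0// exprn_ge0.
by rewrite ler_pM2l ?invr_gt0// lerB// Re_unit_le.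
Qed.

Lemma closest_unique m (A Z : 'M[R[i]]_m) theta : (0 < m)%N ->
  \tr (traceless A *m traceless A) != 0 ->
  \tr (traceless A *m traceless A)
    = `|\tr (traceless A *m traceless A)| * expi theta ->
  closest (@gen_hermitian R m) A Z -> Z = A_hat A theta.
Proof.
move=> m0; set c := \tr _ => c0 cE [GZ minZ].
have hc := Re_conj_expi cE.
have {minZ} := minZ _ (gen_hermitian_A_hat A theta m0).
have /(gen_hermitianP _ m0)[u [u1 hZ]] := GZ.
rewrite normF_le sqnormF_sub_A_hat// hc.
case/(sqnormF_sub_genherm_rigid m0 u1 hZ) => -> uc.
rewrite (A_hatE _ _ m0); congr (_ + rot_herm _ _).
(* Both [u] and [expi theta] rotate [|c|] to [c], which is nonzero. *)
apply: (mulIf c0); rewrite [in LHS]cE -uc.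
by rewrite !mulrA u1 mul1r mulrC.
Qed.

(** * The distance formula and the infinite family *)

Lemma distF_closest m (A Z : 'M[R[i]]_m) G :
  closest G A Z -> distF A G = normF (A - Z).
Proof.
move=> [GZ minZ]; apply/eqP; rewrite eq_le; apply/andP; split.
  by apply: ge_inf; [exists 0 => _ [W _ <-]; exact: sqrtr_ge0 | exists Z].
apply: lb_le_inf; first by exists (normF (A - Z)), Z.
by move=> _ [W GW <-]; exact: minZ.
Qed.

(** For [w = h^* * \tr A], the scalar part contributes [|w|^2 - Re (w^2)], which is twice the square
    of [Im w]. *)
Lemma normF_sub_A_hat m (A : 'M[R[i]]_m) theta : (0 < m)%N ->
  normF (A - A_hat A theta) = Num.sqrt (normF A ^+ 2 / 2
    - 2^-1 * complex.Re (expi (- theta) * \tr (A *m A))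
    - m%:R^-1 * complex.Im (expi (- (theta / 2)) * \tr A) ^+ 2).
Proof.
move=> m0; rewrite {1}/normF -/(sqnormF _); congr Num.sqrt.
rewrite sqnormF_sub_A_hat// mxtrace_traceless_sqr// normF_sqr.
have mR : m%:R != 0 :> R by rewrite pnatr_eq0 -lt0n.
have -> : sqnormF A = m%:R * `|\tr A / m%:R| ^+ 2 + sqnormF (traceless A).
  by rewrite -sqnormF_scalarD ?mxtrace_traceless// -tracelessK.
rewrite !expiN (expi_half theta); set h := expi (theta / 2).
have hh : h * h^* = 1 := expi_unit _.
set w := h^* * \tr A.
have -> : \tr A = h * w by rewrite /w mulrA hh mul1r.
rewrite normf_div normrM (norm_unit hh) mul1r.
have -> : (h ^+ 2)^* * (\tr (A *m A) - m%:R^-1 * (h * w) ^+ 2)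
    = (h ^+ 2)^* * \tr (A *m A) - m%:R^-1 * w ^+ 2.
  rewrite mulrBr; congr (_ - _); rewrite rmorphXn /= exprMn.
  rewrite mulrCA [_ * (h ^+ 2 * _)]mulrA -exprMn [h^* * h]mulrC hh.
  by rewrite expr1n mul1r.
move: (_^* * \tr (A *m A)) w => [p q] [x y].
have [a ->] : exists a : R, sqnormF (traceless A) = a%:C%C.
  by apply/complex_realP/ger0_real/sqnormF_ge0.
rewrite -complexRe expr_div_n normr_nat -add_Re2_Im2.
have -> : m%:R = (m%:R)%:C%C :> R[i] by rewrite rmorph_nat.
have -> : 2 = 2%:C%C :> R[i] by rewrite rmorph_nat.
rewrite -!fmorphV /= !mul0r.
by rewrite !(mulr0, subr0, addr0, expr0n) /=; field.
Qed.

(** For a scalar matrix the family is constant, equal to [A]; otherwise [rot_herm_inj] recovers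
    [expi theta] from the matrix. *)
Lemma infinite_range_A_hat m (A : 'M[R[i]]_m) : (0 < m)%N ->
  ~~ is_scalar_mx A -> infinite_set (range (A_hat A)).
Proof.
move=> m0 nA.
have A0 : traceless A != 0.
  apply: contraNneq nA => h; rewrite (tracelessK A) h addr0.
  exact: scalar_mx_is_scalar.
(* The sample angles [1/(n+1)] lie where [cos] is injective. *)
have inv01 n : n.+1%:R^-1 \in `[0 : R, pi].
  rewrite in_itv /= invr_ge0 ler0n /= (@le_trans _ _ 1)//.
    by rewrite invf_le1 ?ler1n// ltr0n.
  by rewrite (le_trans _ (pi_ge2 R))// ler1n.
have inj : injective (fun n : nat => A_hat A n.+1%:R^-1).
  move=> p q; rewrite !(A_hatE _ _ m0) => /addrI/(rot_herm_inj A0)[/cos_inj].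
  by move=> /(_ (inv01 _) (inv01 _))/invr_inj/eqP; rewrite eqr_nat => /eqP[].
apply: (@sub_infinite_set _ (range (fun n : nat => A_hat A n.+1%:R^-1))).
  by move=> _ [n _ <-]; exists (n.+1%:R^-1).
rewrite (eq_finite_set (inj_card_eq _)); first exact: infinite_nat.
by move=> p q _ _; exact: inj.
Qed.

End GenHermitian.

Theorem proposition3p3 (R : realType) (m : nat) (m_gt0 : (0 < m)%N)
    (A : 'M[R[i]]_m) :
  (m%:R * \tr (A *m A) != (\tr A) ^+ 2 ->
    [/\ closest (@gen_hermitian R m) A (A_hat A (theta_hat A)),
        forall Z, closest (@gen_hermitian R m) A Z -> Z = A_hat A (theta_hat A)
      & distF A (@gen_hermitian R m) =
          Num.sqrt (normF A ^+ 2 / 2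
            - 2^-1 * complex.Re (expi (- theta_hat A)
                                 * \sum_(i < m) \sum_(j < m) A i j * A j i)
            - m%:R^-1 * complex.Im (expi (- (theta_hat A / 2))
                                    * \sum_(i < m) A i i) ^+ 2)])
  /\
  (m%:R * \tr (A *m A) = (\tr A) ^+ 2 ->
    (forall theta : R, closest (@gen_hermitian R m) A (A_hat A theta))
    /\ (~~ is_scalar_mx A -> infinite_set (range (A_hat A)))).
Proof.
set c := \tr (traceless A *m traceless A).
have mC : m%:R != 0 :> R[i] by rewrite pnatr_eq0 -lt0n.
have cE : c = \tr (A *m A) - m%:R^-1 * \tr A ^+ 2.
  exact: mxtrace_traceless_sqr.
have c_eq0 : (c == 0) = (m%:R * \tr (A *m A) == \tr A ^+ 2).
  by rewrite cE subr_eq0 -(inj_eq (mulfI mC)) mulVKf.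
split=> [|/eqP]; rewrite -c_eq0; last first.
  move=> /eqP c0.
  split=> [theta|nA]; last exact: infinite_range_A_hat.
  (* With [c = 0] the polar hypothesis reads [0 = 0]. *)
  by apply: closest_A_hat => //; rewrite -/c c0 normr0 mul0r.
(* Here [c] is nonzero, so the junk value of [argc] at 0 does not arise. *)
move=> c0; have thetaE : c = `|c| * expi (theta_hat A).
  by rewrite /theta_hat -cE; case: (argcP c0).
have Ac : closest (@gen_hermitian R m) A (A_hat A (theta_hat A)).
  exact: closest_A_hat.
split=> //; first by move=> Z; exact: closest_unique.
rewrite (distF_closest Ac) normF_sub_A_hat//.
have -> // : \sum_(i < m) \sum_(j < m) A i j * A j i = \tr (A *m A).
by apply: eq_bigr => i _; rewrite mxE.
Qed.
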